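(* Let $n$ be a positive integer. Then: (1) If $m,q\ge2$, $\mathrm{Aut}(\Delta^{(n)}_{m,q})=\mathcal E(\Delta^{(n)}_{m,q})=S_m\times\prod_{i=1}^nS_q$. (2) If $m\ge2$, $\mathrm{Aut}(\Delta^{(n)}_{m,1})=S_m$ and $\mathcal E(\Delta^{(n)}_{m,1})$ is trivial. (3) If $q\ge2$, $\mathrm{Aut}(\Delta^{(n)}_{1,q})=\prod_{i=1}^nS_q$ and $\mathcal E(\Delta^{(n)}_{1,q})$ is trivial. (4) $\mathrm{Aut}(\Delta^{(n)}_{1,1})=\mathcal E(\Delta^{(n)}_{1,1})$ is trivial. (5) If $m,q\ge2$, $\mathrm{Aut}(\Delta_{m,q})=S_m\times\prod_{i=1}^\infty S_q$ and $\mathcal E(\Delta_{m,q})$ is trivial.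
   Context: Posets are regarded as $T_0$ Alexandroff spaces (open sets = down-sets; continuous maps = order-preserving maps). $\mathrm{Aut}(X)$ is the group of self-homeomorphisms (order automorphisms) of $X$ and $\mathcal E(X)$ the group of homotopy classes of self-homotopy equivalences of $X$; $S_k$ is the symmetric group. $[k]$ is the antichain with $k$ points. The non-Hausdorff join $X\circledast Y$ is $X\sqcup Y$ keeping the orders of $X,Y$ and with $x\le y$ for all $x\in X,y\in Y$. $\Delta^{(n)}_{m,q}=[m]\circledast[q]\circledast\cdots\circledast[q]$ ($n$ copies of $[q]$): elements $x^0_1,\ldots,x^0_m$ and $x^j_i$ ($1\le j\le n$, $1\le i\le q$) with $x^j_i<x^{j'}_{i'}$ iff $j<j'$. $\Delta_{m,q}=[m]\circledast[q]\circledast[q]\circledast\cdots$ is the infinite version (elements $x^j_i$ for all $j\ge0$, same order). *)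

(* Defs.v *)
From HB Require Import structures.
From mathcomp Require Import all_boot all_order all_algebra all_fingroup.
From mathcomp Require Import generic_quotient.
From mathcomp Require Import boolp classical_sets functions reals topology.
From mathcomp Require Import normedtype.

Set Implicit Arguments.
Unset Strict Implicit.
Unset Printing Implicit Defensive.

Import Order.TTheory GRing.Theory Num.Theory numFieldNormedType.Exports.
Local Open Scope classical_set_scope.
Local Open Scope ring_scope.
Local Open Scope quotient_scope.

(* The open sets are the down-sets, so that the minimal neighbourhood of x is
   {y | y <= x}. *)
Definition alexandroff {d : Order.disp_t} (T : porderType d) : Type := T.

Section Alexandroff.
Context {d : Order.disp_t} {T : porderType d}.

HB.instance Definition _ := Choice.on (alexandroff T).

Definition downset : set_system (alexandroff T) :=
  [set U | forall x y : T, (x <= y)%O -> U y -> U x].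

Let downsetT : downset setT. Proof. by []. Qed.

Let downsetI : setI_closed downset.
Proof. by move=> U V dU dV x y xy [Uy Vy]; split; [exact: dU Uy|exact: dV Vy]. Qed.

Let downset_bigcup (I : Type) (f : I -> set (alexandroff T)) :
  (forall i, downset (f i)) -> downset (\bigcup_i f i).
Proof. by move=> df x y xy [i _ fiy]; exists i => //; exact: df fiy. Qed.

HB.instance Definition _ := isOpenTopological.Build (alexandroff T)
  downsetT downsetI downset_bigcup.

End Alexandroff.

Definition antichain (k : nat) : Type := 'I_k.

Section Antichain.
Context {k : nat}.
Implicit Types x y : antichain k.

HB.instance Definition _ := Finite.on (antichain k).

Let le_refl : reflexive (fun x y => x == y). Proof. exact: eqxx. Qed.
Let le_anti : antisymmetric (fun x y => x == y).
Proof. by move=> x y /andP[/eqP]. Qed.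
Let le_trans : transitive (fun x y => x == y).
Proof. by move=> y x z /eqP ->. Qed.

HB.instance Definition _ := Order.Le_isPOrder.Build (Order.Disp tt tt)
  (antichain k) le_refl le_anti le_trans.

Lemma antichain_leE x y : (x <= y)%O = (x == y). Proof. by []. Qed.

End Antichain.

Definition level_size (m q j : nat) : nat := if j is 0 then m else q.

(* A sigma type carries the library's lexicographic order, which for
   antichains is the order of the iterated non-Hausdorff join, bottom level
   first (see deltan_ltE, delta_ltE); Tagged _ i at index j is the point
   x^j_(i+1) and 'I_n.+1 provides the levels 0, ..., n. *)
Definition deltan (n m q : nat) := {j : 'I_n.+1 & antichain (level_size m q j)}.
Definition delta (m q : nat) := {j : nat & antichain (level_size m q j)}.

HB.instance Definition _ n m q := Order.POrder.on (deltan n m q).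
HB.instance Definition _ m q := Order.POrder.on (delta m q).

Lemma deltan_ltE n m q (x y : deltan n m q) :
  (x < y)%O = (tag x < tag y)%N.
Proof.
case: x y => [i x] [j y]; rewrite ltEsig /= !leEord.
case: (ltngtP i j) => //= ij; move/val_inj: ij => ij; subst j.
by rewrite tagged_asE lt_neqAle antichain_leE andNb.
Qed.

Lemma delta_ltE m q (x y : delta m q) : (x < y)%O = (tag x < tag y)%N.
Proof.
case: x y => [i x] [j y]; rewrite ltEsig /= !leEnat.
case: (ltngtP i j) => //= ij; subst j.
by rewrite tagged_asE lt_neqAle antichain_leE andNb.
Qed.

Section FunctionGroup.
Context {I : Type} {G : groupType}.

Let fmul (a b : I -> G) i := (a i * b i)%g.
Let finv (a : I -> G) i := (a i)^-1%g.
Let fone (i : I) : G := 1%g.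

Let fmulA : associative fmul.
Proof. by move=> a b c; apply/funext => i; exact: mulgA. Qed.
Let fmul1 : left_id fone fmul.
Proof. by move=> a; apply/funext => i; exact: mul1g. Qed.
Let fmulr1 : right_id fone fmul.
Proof. by move=> a; apply/funext => i; exact: mulg1. Qed.
Let fmulV : left_inverse fone finv fmul.
Proof. by move=> a; apply/funext => i; exact: mulVg. Qed.
Let fmulrV : right_inverse fone finv fmul.
Proof. by move=> a; apply/funext => i; exact: mulgV. Qed.

HB.instance Definition _ :=
  isGroup.Build (I -> G) fmulA fmul1 fmulr1 fmulV fmulrV.

End FunctionGroup.

Definition isomorphic (G H : groupType) : Prop :=
  exists f : {multiplicative G -> H}, bijective f.

Definition trivial_group (G : groupType) : Prop := forall x : G, x = 1%g.

Definition homeomorphism (X Y : topologicalType) (f : X -> Y) : Prop :=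
  continuous f /\ exists g : Y -> X, [/\ continuous g, cancel f g & cancel g f].

(* Aut(X), with product the composition f \o g *)
Definition homeoAut (X : topologicalType) : Type :=
  {f : X -> X | `[< homeomorphism f >]}.

Section HomeoAut.
Context {X : topologicalType}.
Implicit Types f g h : homeoAut X.

HB.instance Definition _ := SubChoice.on (homeoAut X).

Lemma homeoAutP f : homeomorphism (val f).
Proof. exact/asboolP/(valP f). Qed.

Lemma homeomorphism_id : homeomorphism (@idfun X).
Proof. by split=> [x|]; [|exists idfun; split=> // x]. Qed.

Lemma homeomorphism_comp (u v : X -> X) :
  homeomorphism u -> homeomorphism v -> homeomorphism (u \o v).
Proof.
move=> [cu [u' [cu' uK u'K]]] [cv [v' [cv' vK v'K]]]; split.
  by move=> x; apply: continuous_comp; [exact: cv|exact: cu].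
exists (v' \o u'); split; [|exact: can_comp|exact: can_comp].
by move=> x; apply: continuous_comp; [exact: cu'|exact: cv'].
Qed.

Let inv_ex f : exists g : X -> X,
  [/\ homeomorphism g, cancel (val f) g & cancel g (val f)].
Proof.
have [cf [g [cg fK gK]]] := homeoAutP f.
by exists g; split=> //; split=> //; exists (val f).
Qed.

Let invf f : X -> X := projT1 (cid (inv_ex f)).
Let invf_homeo f : homeomorphism (invf f).
Proof. by rewrite /invf; case: cid => g []. Qed.
Let invfK f : cancel (val f) (invf f).
Proof. by rewrite /invf; case: cid => g []. Qed.
Let invfKV f : cancel (invf f) (val f).
Proof. by rewrite /invf; case: cid => g []. Qed.

Let aone : homeoAut X := exist _ idfun (asboolT homeomorphism_id).
Let amul f g : homeoAut X :=
  exist _ (val f \o val g)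
    (asboolT (homeomorphism_comp (homeoAutP f) (homeoAutP g))).
Let ainv f : homeoAut X := exist _ (invf f) (asboolT (invf_homeo f)).

Let amulA : associative amul. Proof. by move=> f g h; exact: val_inj. Qed.
Let amul1 : left_id aone amul. Proof. by move=> f; exact: val_inj. Qed.
Let amulr1 : right_id aone amul. Proof. by move=> f; exact: val_inj. Qed.
Let amulV : left_inverse aone ainv amul.
Proof. by move=> f; apply: val_inj; apply/funext => x; exact: invfK. Qed.
Let amulrV : right_inverse aone ainv amul.
Proof. by move=> f; apply: val_inj; apply/funext => x; exact: invfKV. Qed.

HB.instance Definition _ :=
  isGroup.Build (homeoAut X) amulA amul1 amulr1 amulV amulrV.

Lemma val_homeoAutM f g : val (f * g)%g = val f \o val g.
Proof. by []. Qed.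

End HomeoAut.

Section Homotopy.
Context (R : realType).

(* The time parameter is taken in R, with continuity only required over the
   unit interval. *)
Definition homotopic (X Y : topologicalType) (f g : X -> Y) : Prop :=
  exists H : X * R -> Y,
    [/\ {within [set: X] `*` `[0, 1]%classic, continuous H},
        (forall x, H (x, 0) = f x) & (forall x, H (x, 1) = g x)].

Definition homotopy_equivalence (X Y : topologicalType) (f : X -> Y) : Prop :=
  continuous f /\ exists g : Y -> X,
    [/\ continuous g, homotopic (g \o f) idfun & homotopic (f \o g) idfun].

Let cts_pair (T U V : topologicalType) (f : T -> U) (g : T -> V) :
  continuous f -> continuous g -> continuous (fun x => (f x, g x)).
Proof.
move=> cf cg x.
exact: (@cvg_pair _ _ _ _ (nbhs (f x)) (nbhs (g x)) _ _ _ f g (cf x) (cg x)).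
Qed.

Let cts_comp (T U V : topologicalType) (f : T -> U) (g : U -> V) :
  continuous f -> continuous g -> continuous (g \o f).
Proof. by move=> cf cg x; apply: continuous_comp; [exact: cf|exact: cg]. Qed.

Let cts_fst (X : topologicalType) : continuous (fun p : X * R => p.1).
Proof. by move=> p; exact: cvg_fst. Qed.

Let cts_snd (X : topologicalType) : continuous (fun p : X * R => p.2).
Proof. by move=> p; exact: cvg_snd. Qed.

Let clamp (t : R) : R := Num.max 0 (Num.min 1 t).

Let clamp_cts : continuous clamp.
Proof.
move=> t; apply: continuous_max; first exact: cvg_cst.
by apply: continuous_min; [exact: cvg_cst|exact: cvg_id].
Qed.

Let clamp0 (t : R) : t <= 0 -> clamp t = 0.
Proof. by move=> t0; rewrite /clamp min_r ?(le_trans t0)// max_l. Qed.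

Let clamp1 (t : R) : 1 <= t -> clamp t = 1.
Proof. by move=> t1; rewrite /clamp min_l// max_r. Qed.

Lemma homotopicP (X Y : topologicalType) (f g : X -> Y) :
  homotopic f g <-> exists H : X * R -> Y,
    [/\ continuous H, (forall x t, t <= 0 -> H (x, t) = f x) &
        (forall x t, 1 <= t -> H (x, t) = g x)].
Proof.
split=> [[H [cH H0 H1]]|[H [cH H0 H1]]]; last first.
  exists H; split=> [|x|x]; [exact: continuous_subspaceT|exact: H0|exact: H1].
pose c (p : X * R) : X * R := (p.1, clamp p.2).
exists (H \o c); split=> [|x t t0|x t t1]; last 2 first.
- by rewrite /= /c /= clamp0.
- by rewrite /= /c /= clamp1.
have cc : continuous c.
  exact: (cts_pair (@cts_fst X) (cts_comp (@cts_snd X) clamp_cts)).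
have cA p : ([set: X] `*` `[0, 1]%classic) (c p).
  split=> //=; rewrite in_itv /= /clamp le_max lexx /=.
  by rewrite ge_max ler01 /= ge_min lexx.
move/subspace_continuousP : cH => cH p U nU.
have := cc p _ (cH _ (cA p) U nU).
by rewrite /nbhs /=; apply: filterS => z; apply; exact: cA.
Qed.

Lemma homotopic_refl (X Y : topologicalType) (f : X -> Y) :
  continuous f -> homotopic f f.
Proof.
move=> cf; apply/homotopicP; exists (f \o fst); split=> //.
exact: (cts_comp (@cts_fst X) cf).
Qed.

Lemma homotopic_sym (X Y : topologicalType) (f g : X -> Y) :
  homotopic f g -> homotopic g f.
Proof.
move=> /homotopicP[H [cH H0 H1]]; apply/homotopicP.
exists (H \o (fun p : X * R => (p.1, 1 - p.2))); split=> [|x t t0|x t t1] /=.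
- apply: cts_comp cH; apply: cts_pair; first exact: cts_fst.
  by move=> p; apply: cvgB; [exact: cvg_cst|exact: cvg_snd].
- by rewrite H1// lerBrDr gerDl.
- by rewrite H0// subr_le0.
Qed.

Lemma homotopic_trans (X Y : topologicalType) (f g h : X -> Y) :
  homotopic f g -> homotopic g h -> homotopic f h.
Proof.
move=> /homotopicP[H [cH H0 H1]] /homotopicP[K [cK K0 K1]]; apply/homotopicP.
pose H' (p : X * R) := H (p.1, p.2 *+ 2).
pose K' (p : X * R) := K (p.1, p.2 *+ 2 - 1).
have c2 : continuous (fun p : X * R => p.2 *+ 2).
  by move=> p; apply: cvgMn; exact: cvg_snd.
have cH' : continuous H'.
  exact: (cts_comp (cts_pair (@cts_fst X) c2) cH).
have cK' : continuous K'.
  have c3 : continuous (fun p : X * R => p.2 *+ 2 - 1).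
    by move=> p; apply: cvgB; [exact: c2|exact: cvg_cst].
  exact: (cts_comp (cts_pair (@cts_fst X) c3) cK).
pose L (p : X * R) := if p.2 *+ 2 <= 1 then H' p else K' p.
pose A := [set p : X * R | p.2 *+ 2 <= 1].
pose B := [set p : X * R | 1 <= p.2 *+ 2].
have cA : closed A.
  apply: (@preimage_closed _ R (fun p : X * R => p.2 *+ 2) [set x | x <= 1]).
    by move=> p _; exact: c2.
  exact: closed_le.
have cB : closed B.
  apply: (@preimage_closed _ R (fun p : X * R => p.2 *+ 2) [set x | 1 <= x]).
    by move=> p _; exact: c2.
  exact: closed_ge.
have LA : {within A, continuous L}.
  apply: (@subspace_eq_continuous _ _ _ H'); last exact: continuous_subspaceT.
  by move=> p /set_mem pA; rewrite /from_subspace /L ifT.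
have LB : {within B, continuous L}.
  apply: (@subspace_eq_continuous _ _ _ K'); last exact: continuous_subspaceT.
  move=> p /set_mem p1; rewrite /from_subspace /L; case: ifPn => // p1'.
  have e : p.2 *+ 2 = 1 by apply/le_anti; rewrite p1 p1'.
  by rewrite /H' /K' e H1// K0// subrr.
exists L; split=> [|x t t0|x t t1].
- apply/continuous_subspace_setT.
  have <- : A `|` B = setT.
    by apply/seteqP; split=> // p _; rewrite /A /B /=; apply/orP; exact: le_total.
  exact: withinU_continuous.
- have t0' : t *+ 2 <= 0 by rewrite mulrn_wle0.
  by rewrite /L /= ifT /H' /= ?H0// (le_trans t0').
- have t2 : 2 <= t *+ 2 by rewrite lerMn2r.
  rewrite /L /= ifN; last by rewrite -ltNge (lt_le_trans _ t2)// ltr1n.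
  by rewrite /K' /= K1// lerBrDr.
Qed.

Lemma homotopic_comp (X Y Z : topologicalType) (f f' : X -> Y) (g g' : Y -> Z) :
  homotopic f f' -> homotopic g g' -> homotopic (g \o f) (g' \o f').
Proof.
move=> /homotopicP[H [cH H0 H1]] /homotopicP[K [cK K0 K1]]; apply/homotopicP.
exists (K \o (fun p : X * R => (H p, p.2))); split=> [|x t t0|x t t1] /=.
- exact: (cts_comp (cts_pair cH (@cts_snd X)) cK).
- by rewrite H0// K0.
- by rewrite H1// K1.
Qed.

Lemma homotopy_equivalence_id (X : topologicalType) :
  homotopy_equivalence (@idfun X).
Proof.
have hid : homotopic (@idfun X) idfun by apply: homotopic_refl => x.
by split=> [x|]; [|exists idfun; split=> // x].
Qed.

Lemma homotopy_equivalence_comp (X Y Z : topologicalType)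
    (f : X -> Y) (g : Y -> Z) :
  homotopy_equivalence f -> homotopy_equivalence g ->
  homotopy_equivalence (g \o f).
Proof.
move=> [cf [f' [cf' ff' f'f]]] [cg [g' [cg' gg' g'g]]]; split.
  by move=> x; apply: continuous_comp; [exact: cf|exact: cg].
exists (f' \o g'); split.
- by move=> x; apply: continuous_comp; [exact: cg'|exact: cf'].
- apply: homotopic_trans ff'.
  apply: (@homotopic_comp _ _ _ f f ((f' \o g') \o g) f').
    exact: homotopic_refl.
  exact: (homotopic_comp gg' (homotopic_refl cf')).
- apply: homotopic_trans g'g.
  apply: (@homotopic_comp _ _ _ g' g' ((g \o f) \o f') g).
    exact: homotopic_refl.
  exact: (homotopic_comp f'f (homotopic_refl cg)).
Qed.

Lemma homeomorphism_homotopy_equivalence (X Y : topologicalType) (f : X -> Y) :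
  homeomorphism f -> homotopy_equivalence f.
Proof.
move=> [cf [g [cg fK gK]]]; split=> //; exists g; split=> //.
- have -> : g \o f = idfun by apply/funext => x; exact: fK.
  by apply: homotopic_refl => x.
- have -> : f \o g = idfun by apply/funext => x; exact: gK.
  by apply: homotopic_refl => x.
Qed.

Definition selfHE (X : topologicalType) : Type :=
  {f : X -> X | `[< homotopy_equivalence f >]}.

HB.instance Definition _ X := SubChoice.on (selfHE X).

Lemma selfHEP X (f : selfHE X) : homotopy_equivalence (val f).
Proof. exact/asboolP/(valP f). Qed.

Definition selfHE_homotopic X (f g : selfHE X) : bool :=
  `[< homotopic (val f) (val g) >].

Let selfHE_refl X : reflexive (@selfHE_homotopic X).
Proof. by move=> f; apply/asboolP/homotopic_refl; case: (selfHEP f). Qed.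
Let selfHE_sym X : symmetric (@selfHE_homotopic X).
Proof.
by move=> f g; apply/asboolP/asboolP; exact: homotopic_sym.
Qed.
Let selfHE_trans X : transitive (@selfHE_homotopic X).
Proof.
by move=> g f h /asboolP fg /asboolP gh; apply/asboolP; exact: homotopic_trans gh.
Qed.

Canonical selfHE_equiv X := EquivRel (@selfHE_homotopic X)
  (@selfHE_refl X) (@selfHE_sym X) (@selfHE_trans X).

(* E(X), with product induced by the composition of representatives *)
Definition hoAut (X : topologicalType) : Type := {eq_quot selfHE_equiv X}.

Section HoAut.
Context {X : topologicalType}.
Implicit Types (f g : selfHE X) (a b c : hoAut X).

HB.instance Definition _ := Choice.on (hoAut X).
HB.instance Definition _ := EqQuotient.on (hoAut X).

Lemma hoAut_eqP f g :
  \pi_(hoAut X) f = \pi_(hoAut X) g <-> homotopic (val f) (val g).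
Proof.
by split=> [/eqP|fg]; [rewrite eqmodE => /asboolP|apply/eqP; rewrite eqmodE; apply/asboolP].
Qed.

Let hone : selfHE X := exist _ idfun (asboolT (homotopy_equivalence_id X)).
Let hmul f g : selfHE X :=
  exist _ (val f \o val g)
    (asboolT (homotopy_equivalence_comp (selfHEP g) (selfHEP f))).

Let hinv_ex f : exists g : selfHE X,
  homotopic (val g \o val f) idfun /\ homotopic (val f \o val g) idfun.
Proof.
have [cf [g [cg gf fg]]] := selfHEP f.
have hg : homotopy_equivalence g by split=> //; exists (val f).
by exists (exist _ g (asboolT hg)).
Qed.

Let hinv f : selfHE X := projT1 (cid (hinv_ex f)).

Let qone : hoAut X := \pi_(hoAut X) hone.
Let qmul a b : hoAut X := \pi_(hoAut X) (hmul (repr a) (repr b)).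
Let qinv a : hoAut X := \pi_(hoAut X) (hinv (repr a)).

Let pi_val_eq f g : val f = val g -> \pi_(hoAut X) f = \pi_(hoAut X) g.
Proof. by move=> /val_inj ->. Qed.

Let qmulE f g : qmul (\pi_(hoAut X) f) (\pi_(hoAut X) g) = \pi_(hoAut X) (hmul f g).
Proof.
apply/hoAut_eqP; apply: homotopic_comp; apply/hoAut_eqP; exact: reprK.
Qed.

Let qmulA : associative qmul.
Proof.
move=> a b c; rewrite -[a]reprK -[b]reprK -[c]reprK.
rewrite (qmulE (repr b) (repr c)) (qmulE (repr a) (repr b)) !qmulE.
by exact: pi_val_eq.
Qed.
Let qmul1 : left_id qone qmul.
Proof.
by move=> a; rewrite -[a]reprK qmulE; exact: pi_val_eq.
Qed.
Let qmulr1 : right_id qone qmul.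
Proof.
by move=> a; rewrite -[a]reprK qmulE; exact: pi_val_eq.
Qed.
Let qmulV : left_inverse qone qinv qmul.
Proof.
move=> a; rewrite -[a in qmul _ a]reprK qmulE; apply/hoAut_eqP.
by rewrite /= /hinv; case: cid => g [].
Qed.
Let qmulrV : right_inverse qone qinv qmul.
Proof.
move=> a; rewrite -[a in qmul a _]reprK qmulE; apply/hoAut_eqP.
by rewrite /= /hinv; case: cid => g [].
Qed.

HB.instance Definition _ :=
  isGroup.Build (hoAut X) qmulA qmul1 qmulr1 qmulV qmulrV.

Lemma hoAut_piM f g :
  exists h : selfHE X, val h = val f \o val g /\
    (\pi_(hoAut X) f * \pi_(hoAut X) g)%g = \pi_(hoAut X) h.
Proof. by exists (hmul f g); split=> //; exact: qmulE. Qed.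

(* the canonical morphism Aut(X) -> E(X) *)
Definition hoClass (f : homeoAut X) : hoAut X :=
  \pi_(hoAut X) (exist _ (val f)
    (asboolT (homeomorphism_homotopy_equivalence (homeoAutP f)))).

Let hoClassM : {morph hoClass : f g / (f * g)%g}.
Proof.
by move=> f g; apply/esym; rewrite [LHS]qmulE; exact: pi_val_eq.
Qed.

HB.instance Definition _ :=
  isMultiplicative.Build (homeoAut X) (hoAut X) hoClass hoClassM.

End HoAut.

End Homotopy.

Arguments hoClass R X : clear implicits.

(* Main.v *)
(* In a finite join of antichains with at least two points each, a monotone map
   g with g <= id or g >= id is the identity, because a point is pinned down by
   two incomparable points of the level below (resp. above) it.  Along a homotopy
   ending at the identity, the times at which it equals the identity therefore
   form a clopen set, so homotopic automorphisms are equal.  Automorphisms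
   preserve the level of a point, and any choice of one permutation per level
   is an automorphism.  If the bottom or the top level is a point, or if there
   are infinitely many levels, a fence id <= S >= const contracts the space. *)
Require Import Defs.
From HB Require Import structures.
From mathcomp Require Import all_boot all_order all_algebra all_fingroup.
From mathcomp Require Import boolp classical_sets functions reals topology.
From mathcomp Require Import generic_quotient normedtype.

Set Implicit Arguments.
Unset Strict Implicit.
Unset Printing Implicit Defensive.

Import Order.TTheory GRing.Theory Num.Theory numFieldNormedType.Exports.
Local Open Scope classical_set_scope.
Local Open Scope ring_scope.

(** * Neighbourhoods and continuity in Alexandroff spaces *)

Lemma nbhs_alexandroffP d (T : porderType d) (x : alexandroff T)
    (U : set (alexandroff T)) :
  nbhs x U <-> (forall y : T, (y <= x)%O -> U y).
Proof.
split=> [|xU].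
  by rewrite nbhsE => -[V [oV Vx] VU] y yx; apply: VU; exact: oV yx Vx.
rewrite nbhsE; exists [set y : alexandroff T | ((y : T) <= x)%O] => //.
by split=> /=; [move=> y z yz; exact: le_trans|exact: lexx].
Qed.

Lemma continuous_alexandroffP d d' (S : porderType d) (T : porderType d')
    (f : alexandroff S -> alexandroff T) :
  continuous f <-> {homo (f : S -> T) : x y / (x <= y)%O}.
Proof.
split=> [cf x y xy|fh x U /nbhs_alexandroffP fU].
  have /cf/nbhs_alexandroffP : nbhs (f y) [set z : T | (z <= f y)%O].
    by apply/nbhs_alexandroffP.
  exact.
by apply/nbhs_alexandroffP => y yx; apply: fU; exact: fh.
Qed.

(** * Homotopies between maps into posets *)

Section HomotopyAlexandroff.
Context (R : realType).

(** The homotopy stays at [f] for times below 1, an open condition, then jumps to [g]. Continuity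
    after the jump holds because, for [y] near [x], both [f y] and [g y] lie below [g x], hence in
    every neighbourhood of [g x]. *)
Lemma homotopic_le (X : topologicalType) d (T : porderType d)
    (f g : X -> alexandroff T) :
  continuous f -> continuous g -> (forall x, ((f x : T) <= g x)%O) ->
  homotopic R f g.
Proof.
move=> cf cg fg.
exists (fun p => if p.2 < 1 then f p.1 else g p.1); split=> [|x|x] /=;
  rewrite ?ltr01 ?ltxx//.
apply: continuous_subspaceT => -[x t] U /= /nbhs_alexandroffP tU.
have [t1|t1] := ltP t 1.
  rewrite t1 in tU.
  have fU : nbhs x (f @^-1` U) by apply: cf; apply/nbhs_alexandroffP.
  exists (f @^-1` U, [set s | s < 1]); first by split=> //; exact: lt_nbhsl.
  by move=> [y s] [/= Uy s1]; rewrite s1.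
rewrite ltNge t1 /= in tU.
have gU : nbhs x (g @^-1` [set y : T | (y <= g x)%O]).
  by apply: cg; apply/nbhs_alexandroffP.
exists (g @^-1` [set y : T | (y <= g x)%O], setT).
  by split=> //; exact: filterT.
move=> [y s] [/= gy _]; apply: tU; case: ifP => // _.
exact: le_trans gy.
Qed.

(** Precomposing the contraction with any self-equivalence makes it homotopic to the same constant,
    so only one class remains. *)
Lemma trivial_hoAut (X : topologicalType) (c : X) :
  homotopic R (@idfun X) (fun=> c) -> trivial_group (hoAut R X).
Proof.
move=> idc a; rewrite -[a]reprK -[1%g]reprK; apply/hoAut_eqP.
have fc (f : selfHE R X) : homotopic R (val f) (fun=> c).
  have [cf _] := selfHEP f.
  exact: (homotopic_comp (homotopic_refl R cf) idc).
exact: homotopic_trans (fc _) (homotopic_sym (fc _)).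
Qed.

(** * Rigidity: homotopic automorphisms of certain finite posets coincide *)

Section Rigid.
Context d (T : finPOrderType d).
Let X := alexandroff T.

Context (deflation_id : forall g : T -> T,
  {homo g : x y / (x <= y)%O} -> (forall x, (g x <= x)%O) -> g =1 id).
Context (inflation_id : forall g : T -> T,
  {homo g : x y / (x <= y)%O} -> (forall x, (x <= g x)%O) -> g =1 id).

(* By finiteness H_s <= H_t for s near t; hence the times t with H_t = id form
   a clopen subset of R. *)
Lemma homotopic_id_eq (f : X -> X) : homotopic R f idfun -> f = idfun.
Proof.
move=> /homotopicP[H [cH H0 H1]].
have near_le t : \forall s \near t, forall x : T, ((H (x, s) : T) <= H (x, t))%O.
  apply: (filter_forall (nbhs_filter t)) => x.
  have /cH[[U V] /= [Ux Vt] UV] :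
    nbhs (H (x, t)) [set y : T | (y <= H (x, t))%O].
    by apply/nbhs_alexandroffP.
   apply: filterS Vt => s Vs; apply: (UV (x, s)); split=> //=.
  exact: nbhs_singleton Ux.
have homoH t : {homo (fun x : T => H (x, t) : T) : x y / (x <= y)%O}.
  apply/(@continuous_alexandroffP _ _ T T (fun x => H (x, t))) => x.
  apply: (@continuous_comp _ _ _ (fun x : X => (x, t)) H); last exact: cH.
  exact: (@cvg_pair _ _ _ (nbhs x) (nbhs x) (nbhs t) _ _ _ id (cst t)
    cvg_id (cvg_cst t)).
pose A := [set t : R | forall x, H (x, t) = x].
have oA : open A.
  rewrite openE => t At; rewrite /interior /=.
  apply: filterS (near_le t) => s Hs x; apply: (deflation_id (homoH s)) => y.
  by rewrite -[leRHS](At y).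
have cA : closed A.
  (* A limit time [t] of [A] has some [s] in [A] near it, so that id = H_s <= H_t. *)
  move=> t /(_ _ (near_le t))[s [As Hs]] x; apply: (inflation_id (homoH t)) => y.
  by rewrite -[leLHS](As y).
have AT : A = setT.
  have : connected [set: R] by apply/connected_intervalP.
  apply; first by exists 1 => x; exact: H1.
    by exists A; rewrite ?setTI.
  by exists A; rewrite ?setTI.
have A0 : A 0 by rewrite AT.
by apply/funext => x; rewrite -[LHS](H0 x 0)// A0.
Qed.

(** A homotopy inverse is a strict inverse by [homotopic_id_eq], which gives surjectivity. For
    injectivity, a homotopy from [f] to [g] is composed with the inverse of [f]. *)
Lemma bijective_hoClass : bijective (hoClass R X).
Proof.
have homeo (f : selfHE R X) : homeomorphism (val f).
  have [cf [g [cg gf fg]]] := selfHEP f; split=> //; exists g; split=> // x.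
    by have := congr1 (@^~ x) (homotopic_id_eq gf).
  by have := congr1 (@^~ x) (homotopic_id_eq fg).
pose lift (a : hoAut R X) : homeoAut X :=
  exist _ (val (repr a)) (asboolT (homeo (repr a))).
have liftK : cancel lift (hoClass R X).
  move=> a; rewrite -[RHS]reprK; apply/hoAut_eqP => /=.
  by apply: homotopic_refl; case: (selfHEP (repr a)).
have inj : injective (hoClass R X).
  move=> f g /hoAut_eqP /= fg; have [cf [f' [cf' fK f'K]]] := homeoAutP f.
  have := homotopic_comp fg (homotopic_refl R cf').
  have -> : f' \o val f = idfun by apply/funext => x; exact: fK.
  move=> /homotopic_sym/homotopic_id_eq f'g; apply/val_inj/funext => x.
  by rewrite -[in RHS](f'K (val g x)); have /= -> := congr1 (@^~ x) f'g.
by exists lift => // f; apply: inj; rewrite liftK.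
Qed.

End Rigid.
End HomotopyAlexandroff.

(** * Isomorphisms of groups and trivial factors *)

Lemma isomorphic_morph (G H : groupType) (f : G -> H) :
  {morph f : x y / (x * y)%g} -> bijective f -> isomorphic G H.
Proof.
move=> fM bf; pose fm := isMultiplicative.Build G H f fM.
by pose ff : {multiplicative G -> H} := HB.pack f fm; exists ff.
Qed.

Lemma isomorphic_trans (G H K : groupType) :
  isomorphic G H -> isomorphic H K -> isomorphic G K.
Proof.
move=> [f bf] [g bg]; apply: (@isomorphic_morph _ _ (g \o f)).
  by move=> x y /=; rewrite !gmulfM.
exact: bij_comp bg bf.
Qed.

Lemma isomorphic_sym (G H : groupType) : isomorphic G H -> isomorphic H G.
Proof.
move=> [f [g fK gK]]; apply: (@isomorphic_morph _ _ g); last by exists f.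
by move=> x y; apply: (can_inj fK); rewrite gmulfM !gK.
Qed.

(** Inversion repairs the order of the product. This is needed because a product of permutations
    applies its left factor first, while the product in [homeoAut] is [f \o g]. *)
Lemma isomorphic_anti (G H : groupType) (f : G -> H) :
  {morph f : x y / (x * y)%g >-> (y * x)%g} -> bijective f -> isomorphic G H.
Proof.
move=> fM bf; apply: (@isomorphic_morph _ _ (f \o invg)).
  by move=> x y /=; rewrite invgM fM.
by apply: bij_comp bf _; exists invg; exact: invgK.
Qed.

Lemma isomorphic_prodl (G H : groupType) :
  trivial_group H -> isomorphic (G * H)%type G.
Proof.
move=> H1; apply: (@isomorphic_morph _ _ fst) => //.
by exists (pair^~ 1%g) => // -[x y]; rewrite (H1 y).
Qed.

Lemma isomorphic_prodr (G H : groupType) :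
  trivial_group G -> isomorphic (G * H)%type H.
Proof.
move=> G1; apply: (@isomorphic_morph _ _ snd) => //.
by exists (pair 1%g) => // -[x y]; rewrite (G1 x).
Qed.

Lemma trivial_group_perm1 : trivial_group 'S_1.
Proof. by move=> s; apply/permP => i; rewrite !ord1. Qed.

Lemma trivial_group_ffun (I : finType) (G : groupType) :
  trivial_group G -> trivial_group {ffun I -> G}.
Proof. by move=> G1 f; apply/ffunP => i; rewrite ffunE (G1 (f i)). Qed.

Lemma trivial_group_prod (G H : groupType) :
  trivial_group G -> trivial_group H -> trivial_group (G * H)%type.
Proof. by move=> G1 H1 [x y]; rewrite (G1 x) (H1 y). Qed.

Lemma trivial_group_isomorphic (G H : groupType) :
  isomorphic G H -> trivial_group H -> trivial_group G.
Proof. by move=> [f [g fK _]] H1 x; rewrite -[x]fK -[1%g in RHS]fK !(H1 (f _)). Qed.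

(** * Maps that permute each level separately *)

Local Notation point sz i := (Tagged (fun j => antichain (sz j)) i).

Section LevelPerm.
Context (J : eqType) (sz : J -> nat).
Let T := {j : J & antichain (sz j)}.

Definition level_perm (s : forall j, 'S_(sz j)) (x : T) : T :=
  point sz (s (tag x) (tagged x)).

Lemma level_perm_comp (s t : forall j, 'S_(sz j)) :
  level_perm s \o level_perm t = level_perm (fun j => t j * s j)%g.
Proof. by apply/funext => -[j i]; rewrite /level_perm /= permM. Qed.

Lemma level_perm_inj (s t : forall j, 'S_(sz j)) :
  level_perm s = level_perm t -> forall j, s j = t j.
Proof.
move=> st j; apply/permP => i.
have /eqP := congr1 (@^~ (point sz i)) st.
by rewrite /level_perm /= eq_Tagged => /eqP.
Qed.

Lemma level_permP (f : T -> T) :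
  injective f -> (forall x, tag (f x) = tag x) ->
  exists s, f = level_perm s.
Proof.
move=> finj ftag.
(* [tagged_as] casts the image back to level [j]; its fallback value [i] never occurs, since [f]
   preserves tags. *)
pose g j (i : 'I_(sz j)) : 'I_(sz j) :=
  tagged_as (point sz i) (f (point sz i)).
have gE j i : f (point sz i) = point sz (g j i).
  have /= := ftag (point sz i); rewrite /g; case: (f _) => k l /= kj.
  by subst k; rewrite tagged_asE.
have ginj j : injective (g j).
  move=> a b gab; have /finj/eqP : f (point sz a) = f (point sz b).
    by rewrite !gE gab.
  by rewrite eq_Tagged => /eqP.
exists (fun j => perm (ginj j)); apply/funext => -[j i].
by rewrite /level_perm /= permE -gE.
Qed.

End LevelPerm.

(** * Automorphisms of a join of antichains *)

Section Levels.
(** The rank [v] embeds the index order in [nat] with a downward closed image; this covers ['I_n.+1]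
    and [nat] together. *)
Context dJ (J : orderType dJ) (v : J -> nat) (sz : J -> nat).
Context (vE : forall i j : J, (i < j)%O = (v i < v j)%N).
Context (v_below : forall (j : J) k, (k <= v j)%N -> exists i, v i = k).
Context (sz_gt0 : forall j, (0 < sz j)%N).
Notation T := {j : J & antichain (sz j)}.
Implicit Types x y z : T.

Lemma v_inj : injective v.
Proof. by move=> i j vij; case: (ltgtP i j) => //; rewrite vE vij ltnn. Qed.

Lemma level_ltE x y : (x < y)%O = (v (tag x) < v (tag y))%N.
Proof.
case: x y => [i x] [j y]; rewrite ltEsig /= -vE.
case: (ltgtP i j) => //= ij; subst j.
by rewrite tagged_asE lt_neqAle antichain_leE andNb.
Qed.

Lemma level_homo (f : T -> T) :
  (forall x, tag (f x) = tag x) -> {homo f : x y / (x <= y)%O}.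
Proof.
move=> ftag x y; rewrite !le_eqVlt => /orP[/eqP->|]; first by rewrite eqxx.
by rewrite !level_ltE !ftag => ->; rewrite orbT.
Qed.

Lemma homeomorphism_level_perm (s : forall j, 'S_(sz j)) :
  homeomorphism (level_perm s : alexandroff T -> alexandroff T).
Proof.
split; first exact/continuous_alexandroffP/level_homo.
exists (level_perm (fun j => (s j)^-1%g)); split.
- exact/continuous_alexandroffP/level_homo.
- by move=> [j i]; rewrite /level_perm /= permK.
- by move=> [j i]; rewrite /level_perm /= permKV.
Qed.

Lemma level_point (x : T) k : (k <= v (tag x))%N -> exists y, v (tag y) = k.
Proof.
by move=> /v_below[i <-]; exists (point sz (Ordinal (sz_gt0 i) : antichain _)).
Qed.

(** Induction on the rank: a point of rank [j.+1] lies above one of rank [j], whose image has rank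
    at least [j] and strictly below that of [f x]. *)
Lemma homo_lt_level (f : T -> T) :
  {homo f : x y / (x < y)%O} -> forall x, (v (tag x) <= v (tag (f x)))%N.
Proof.
move=> fh x; have [k] := ubnP (v (tag x)); elim: k x => // k IH x xk.
case vx : (v (tag x)) => [//|j].
have [y vy] : exists y, v (tag y) = j by apply: (@level_point x); rewrite vx.
have := fh y x; rewrite !level_ltE vx vy => /(_ (ltnSn j)); apply: leq_ltn_trans.
by rewrite -{1}vy IH// vy -ltnS -vx.
Qed.

(** An automorphism and its inverse are both strictly monotone, so neither lowers the rank. *)
Lemma homeomorphism_tag (f : alexandroff T -> alexandroff T) :
  homeomorphism f -> forall x : T, tag (f x : T) = tag x.
Proof.
have homo_lt (h k : T -> T) : {homo h : x y / (x <= y)%O} -> cancel h k ->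
    {homo h : x y / (x < y)%O}.
  move=> hh hK x y; rewrite !lt_neqAle => /andP[xy /hh ->].
  by rewrite (can_eq hK) xy.
move=> [/continuous_alexandroffP cf [g [/continuous_alexandroffP cg fK gK]]] x.
apply/v_inj/eqP; rewrite eqn_leq (homo_lt_level (homo_lt _ _ cf fK)) andbT.
by rewrite -{2}[x]fK (homo_lt_level (homo_lt _ _ cg gK)).
Qed.

(** The hypotheses say, level by level, that [s] identifies [G] with the product of the groups
    ['S_(sz j)]. *)
Lemma isomorphic_homeoAut (G : groupType) (s : G -> forall j, 'S_(sz j)) :
  (forall a b j, s (a * b)%g j = (s a j * s b j)%g) ->
  (forall a b, (forall j, s a j = s b j) -> a = b) ->
  (forall t : forall j, 'S_(sz j), exists a, forall j, s a j = t j) ->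
  isomorphic (homeoAut (alexandroff T)) G.
Proof.
move=> sM sinj ssurj; apply: isomorphic_sym.
pose F a : homeoAut (alexandroff T) :=
  exist _ (level_perm (s a)) (asboolT (homeomorphism_level_perm (s a))).
have Finj : injective F.
  by move=> a b /(congr1 val) /= /level_perm_inj; exact: sinj.
have Fsurj f : exists a, F a = f.
  have hf := homeoAutP f; have [_ [g [_ /can_inj fI _]]] := hf.
  have [t ft] := level_permP fI (homeomorphism_tag hf).
  have [a at_] := ssurj t; exists a; apply: val_inj; rewrite /= ft.
  by congr level_perm; apply: functional_extensionality_dep.
apply: (@isomorphic_anti _ _ F).
  move=> a b; apply: val_inj; rewrite val_homeoAutM /= level_perm_comp.
  by congr level_perm; apply: functional_extensionality_dep => j; rewrite sM.
have [h hE] := choice Fsurj.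
by exists h => // a; apply: Finj; rewrite hE.
Qed.

(** * Monotone maps comparable with the identity, when levels have two points *)

Section TwoPoints.
Context (sz_gt1 : forall j, (1 < sz j)%N).

Lemma level_two_points (x : T) k : (k <= v (tag x))%N ->
  exists y z, [/\ v (tag y) = k, v (tag z) = k & y != z].
Proof.
move=> /v_below[i <-].
exists (point sz (Ordinal (sz_gt0 i) : antichain _)).
exists (point sz (Ordinal (sz_gt1 i) : antichain _)).
by split=> //; rewrite eq_Tagged.
Qed.

Lemma level_deflation_id (g : T -> T) :
  {homo g : x y / (x <= y)%O} -> (forall x, (g x <= x)%O) -> g =1 id.
Proof.
move=> gh gle x; have [k] := ubnP (v (tag x)); elim: k x => // k IH x xk.
apply/eqP; have := gle x; rewrite le_eqVlt => /orP[//|gx].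
have := gx; rewrite level_ltE; case vx : (v (tag x)) => [//|j] gxj.
have [y [z [vy vz]]] : exists y z, [/\ v (tag y) = j, v (tag z) = j & y != z].
  by apply: (@level_two_points x); rewrite vx.
(* By induction [w] is fixed, so [w <= g x]; as [g x] has rank at most [j], they are equal. *)
have fixed w : v (tag w) = j -> w = g x.
  move=> vw; have : (g w <= g x)%O.
    by apply/gh/ltW; rewrite level_ltE vw vx.
  rewrite (IH w); last by rewrite vw -ltnS -vx.
  rewrite le_eqVlt level_ltE vw => /orP[/eqP//|].
  by move=> /leq_trans/(_ gxj); rewrite ltnn.
by rewrite (fixed y)// (fixed z)// eqxx.
Qed.

Lemma level_inflation_id N (g : T -> T) : (forall j, v j <= N)%N ->
  {homo g : x y / (x <= y)%O} -> (forall x, (x <= g x)%O) -> g =1 id.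
Proof.
move=> vN gh gge x; have [k] := ubnP (N - v (tag x)); elim: k x => // k IH x xk.
apply/eqP; have := gge x; rewrite le_eqVlt eq_sym => /orP[//|gx].
(* The level just above [x] exists because [g x] lies on it or higher; the bound [N] lets the
   induction descend from the top. *)
have := gx; rewrite level_ltE => /[dup] vxg /level_two_points[y [z [vy vz]]].
have fixed w : v (tag w) = (v (tag x)).+1 -> w = g x.
  move=> vw; have : (g x <= g w)%O.
    by apply/gh/ltW; rewrite level_ltE vw.
  rewrite (IH w); last first.
    have := vN (tag (g x)) => /(leq_trans vxg) xN.
    by rewrite vw -ltnS (leq_trans _ xk)// ltnS ltn_sub2l.
  rewrite le_eqVlt level_ltE vw => /orP[/eqP//|].
  by rewrite ltnNge vxg.
by rewrite (fixed y)// (fixed z)// eqxx.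
Qed.

End TwoPoints.
End Levels.

(** * The automorphism groups of the finite and infinite joins *)

Definition level_family m q (a : 'S_m) (b : nat -> 'S_q) (j : nat) :
    'S_(level_size m q j) :=
  if j is k.+1 then b k else a.

Lemma level_size_gt m q k : (k < m)%N -> (k < q)%N ->
  forall j, (k < level_size m q j)%N.
Proof. by move=> km kq []. Qed.

Section Finite.
Context (n m q : nat).
Let v (j : 'I_n.+1) : nat := j.
Let sz (j : 'I_n.+1) : nat := level_size m q j.

Let v_below (j : 'I_n.+1) k : (k <= v j)%N -> exists i, v i = k.
Proof. by move=> kj; exists (Ordinal (leq_ltn_trans kj (ltn_ord j))). Qed.

(** Component [k] of [a.2] acts on level [k.+1]. The default [1%g] is never reached, since
    [k.+1 < n.+1]. *)
Let family (a : 'S_m * {ffun 'I_n -> 'S_q}) (j : 'I_n.+1) : 'S_(sz j) :=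
  level_family a.1 (fun k => oapp a.2 1%g (insub k)) j.

Lemma isomorphic_homeoAut_deltan : (0 < m)%N -> (0 < q)%N ->
  isomorphic (homeoAut (alexandroff (deltan n m q)))
    ('S_m * {ffun 'I_n -> 'S_q})%type.
Proof.
move=> m0 q0; pose v0 (j : 'I_n.+1) := level_size_gt m0 q0 j.
apply: (@isomorphic_homeoAut _ _ v sz _ v_below v0 _ family) => [i j|a b j|a b ab|t].
- by [].
- case: j => [[|k] kn]; rewrite /family /level_family /=; first by [].
  by rewrite (insubT (fun k => k < n)%N kn) /= ffunE.
- case: a b ab => [a a'] [b b'] ab; congr (_, _); first exact: (ab ord0).
  apply/ffunP => k; have := ab (lift ord0 k).
  by rewrite /family /level_family /= (insubT (fun k => k < n)%N (ltn_ord k)) /=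
    (_ : Sub _ _ = k)//; exact: val_inj.
- pose b := [ffun k : 'I_n => t (Ordinal (ltn_ord k : k.+1 < n.+1)%N) : 'S_q].
  (* The same level arises with different proofs of its bound; the values of [t] there agree. *)
  have tE k (h h' : (k < n.+1)%N) : t (Ordinal h) = t (Ordinal h').
    by rewrite (bool_irrelevance h h').
  exists (t ord0 : 'S_m, b) => -[[|k] kn]; first exact: (tE 0%N (ltn0Sn n) kn).
  rewrite /family /level_family /= (insubT (fun k => k < n)%N kn) /= ffunE.
  exact: (tE k.+1 (ltn_ord (Ordinal (kn : (k < n)%N))) kn).
Qed.

Lemma bijective_hoClass_deltan (R : realType) : (2 <= m)%N -> (2 <= q)%N ->
  bijective (hoClass R (alexandroff (deltan n m q))).
Proof.
move=> m2 q2; pose v0 (j : 'I_n.+1) := level_size_gt (ltnW m2) (ltnW q2) j.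
pose v1 (j : 'I_n.+1) := level_size_gt m2 q2 j.
apply: bijective_hoClass.
- exact: (@level_deflation_id _ _ v sz (fun _ _ => erefl) v_below v0 v1).
- move=> g; apply: (@level_inflation_id _ _ v sz (fun _ _ => erefl) v_below v0 v1 n) => j.
  by rewrite -ltnS ltn_ord.
Qed.

End Finite.

Lemma isomorphic_homeoAut_delta m q : (0 < m)%N -> (0 < q)%N ->
  isomorphic (homeoAut (alexandroff (delta m q))) ('S_m * (nat -> 'S_q))%type.
Proof.
move=> m0 q0.
apply: (@isomorphic_homeoAut _ _ id (level_size m q) _ _ (level_size_gt m0 q0) _
  (fun a => level_family a.1 a.2)) => [i j|j k|a b [|j]|[a a'] [b b'] ab|t] //.
- by exists k.
- by congr (_, _); [exact: (ab 0%N)|apply/funext => j; exact: (ab j.+1)].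
- by exists (t 0%N : 'S_m, (fun j => t j.+1 : 'S_q)) => -[].
Qed.

(** * Contractible joins *)

Section Contractible.
Context (R : realType).

Lemma trivial_hoAut_greatest d (T : porderType d) (c : T) :
  (forall x, (x <= c)%O) -> trivial_group (hoAut R (alexandroff T)).
Proof.
move=> xc; apply: (@trivial_hoAut _ (alexandroff T) c).
by apply: homotopic_le => [x|x|x]; [exact: cvg_id|exact: cst_continuous|exact: xc].
Qed.

Lemma trivial_hoAut_least d (T : porderType d) (c : T) :
  (forall x, (c <= x)%O) -> trivial_group (hoAut R (alexandroff T)).
Proof.
move=> cx; apply: (@trivial_hoAut _ (alexandroff T) c).
apply: homotopic_sym.
by apply: homotopic_le => [x|x|x]; [exact: cst_continuous|exact: cvg_id|exact: cx].
Qed.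

(** For positive [n] the top level is a copy of [[1]], and its point is the greatest element. *)
Lemma trivial_hoAut_deltan_top n m : (0 < n)%N ->
  trivial_group (hoAut R (alexandroff (deltan n m 1))).
Proof.
case: n => // n _.
apply: (@trivial_hoAut_greatest _ _
  (Tagged (fun j : 'I_n.+2 => antichain (level_size m 1 j)) (i := ord_max)
    (ord0 : antichain 1))) => -[j i].
rewrite le_eqVlt deltan_ltE /=.
have := ltn_ord j; rewrite ltnS leq_eqVlt => /orP[/eqP jn|->]; last first.
  by rewrite orbT.
have {}jn : j = ord_max by exact: val_inj.
by subst j; rewrite eq_Tagged /= [i]ord1 eqxx.
Qed.

(** The only point of level 0 is the least element. *)
Lemma trivial_hoAut_deltan_bottom n q :
  trivial_group (hoAut R (alexandroff (deltan n 1 q))).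
Proof.
apply: (@trivial_hoAut_least _ _
  (Tagged (fun j : 'I_n.+1 => antichain (level_size 1 q j)) (i := ord0)
    (ord0 : antichain 1))) => -[j i].
rewrite le_eqVlt deltan_ltE /=.
have [j0|j0] := posnP j; last by rewrite orbT.
have {}j0 : j = ord0 by exact: val_inj.
by subst j; rewrite eq_Tagged /= [i]ord1 eqxx.
Qed.

(* The map S sending every point to one fixed point of the next level satisfies
   id <= S >= const, so the identity is homotopic to a constant. *)
Lemma trivial_hoAut_delta m q : (0 < m)%N -> (0 < q)%N ->
  trivial_group (hoAut R (alexandroff (delta m q))).
Proof.
move=> m0 q0.
pose p j : delta m q :=
  point (level_size m q) (Ordinal (level_size_gt m0 q0 j) : antichain _).
pose S (x : alexandroff (delta m q)) : alexandroff (delta m q) := p (tag x).+1.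
have cS : continuous S.
  apply/continuous_alexandroffP => x y; rewrite le_eqVlt => /orP[/eqP->//|].
  by rewrite delta_ltE => xy; apply: ltW; rewrite delta_ltE.
apply: (@trivial_hoAut _ (alexandroff (delta m q)) (p 0%N)); apply: (@homotopic_trans _ _ _ _ S).
  apply: homotopic_le => [x|//|x]; first exact: cvg_id.
  by apply: ltW; rewrite delta_ltE.
apply: homotopic_sym; apply: homotopic_le => [x|//|x]; first exact: cst_continuous.
by apply: ltW; rewrite delta_ltE.
Qed.

End Contractible.

(** * Automorphisms and self-equivalences in the five cases *)

Theorem theorem5p20 (R : realType) (n : nat) (n_gt0 : (0 < n)%N) :
  (forall m q : nat, (2 <= m)%N -> (2 <= q)%N ->
     let X := alexandroff (deltan n m q) in
     [/\ bijective (hoClass R X),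
         isomorphic (homeoAut X) ('S_m * {ffun 'I_n -> 'S_q})%type
       & isomorphic (hoAut R X) ('S_m * {ffun 'I_n -> 'S_q})%type]) /\
  (forall m : nat, (2 <= m)%N ->
     let X := alexandroff (deltan n m 1) in
     isomorphic (homeoAut X) 'S_m /\ trivial_group (hoAut R X)) /\
  (forall q : nat, (2 <= q)%N ->
     let X := alexandroff (deltan n 1 q) in
     isomorphic (homeoAut X) {ffun 'I_n -> 'S_q} /\
     trivial_group (hoAut R X)) /\
  (let X := alexandroff (deltan n 1 1) in
     [/\ bijective (hoClass R X),
         trivial_group (homeoAut X)
       & trivial_group (hoAut R X)]) /\
  (forall m q : nat, (2 <= m)%N -> (2 <= q)%N ->
     let X := alexandroff (delta m q) in
     isomorphic (homeoAut X) ('S_m * (nat -> 'S_q))%type /\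
     trivial_group (hoAut R X)).
Proof.
have autE m q := @isomorphic_homeoAut_deltan n m q.
split; [|split; [|split; [|split]]].
- move=> m q m2 q2 X; have bij := @bijective_hoClass_deltan n m q R m2 q2.
  have aut := autE m q (ltnW m2) (ltnW q2); split=> //.
  (* [hoClass] is a bijective morphism, so the description of [homeoAut X] carries over to
     [hoAut R X]. *)
  apply: isomorphic_trans aut; apply: isomorphic_sym.
  by exists (hoClass R X).
- move=> m m2 X; split; last exact: trivial_hoAut_deltan_top.
  apply: isomorphic_trans (autE m 1%N (ltnW m2) isT) _.
  exact/isomorphic_prodl/trivial_group_ffun/trivial_group_perm1.
- move=> q q2 X; split; last exact: trivial_hoAut_deltan_bottom.
  apply: isomorphic_trans (autE 1%N q isT (ltnW q2)) _.
  exact/isomorphic_prodr/trivial_group_perm1.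
- move=> X; have autX : trivial_group (homeoAut X).
    apply: trivial_group_isomorphic (autE 1%N 1%N isT isT) _.
    apply: trivial_group_prod; first exact: trivial_group_perm1.
    exact/trivial_group_ffun/trivial_group_perm1.
  have hoX : trivial_group (hoAut R X) by exact: trivial_hoAut_deltan_bottom.
  (* Between trivial groups the constant map at 1 is a two-sided inverse. *)
  split=> //; exists (fun=> 1%g) => f.
    by rewrite (autX f).
  by rewrite (hoX f) (hoX (hoClass _ _ _)).
- move=> m q m2 q2 X; split.
    exact: isomorphic_homeoAut_delta (ltnW m2) (ltnW q2).
  exact: trivial_hoAut_delta (ltnW m2) (ltnW q2).
Qed.
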